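(* Let $\{x_t^*,p_t^*\}_{t=1}^T$ be the optimal solution of the problem $\mathsf{Q}_{\mathrm{GS}}'$ and let $\{p_t^{\mathrm{MR}}\}_{t=1}^T$ be the optimal power allocation of the problem $\mathsf{Q}_{\mathrm{GS}}$ under the additional condition $x_t=1$ for all $t$ (both problems are defined in the context). Then for every $t$ $$p_t^{\mathrm{MR}}=\frac{\sigma^2\left(2^{I/(\tau B)}-1\right)}{|h_t|^2},$$ and the GS power saving factor $\Delta P:=\sum_{t=1}^Tp_t^{\mathrm{MR}}-\sum_{t=1}^Tp_t^*$ equals $$\Delta P=\sum_{t=1}^T\frac{\sigma^2\,\mathbb{I}_{\{L_t\le L_{\mathrm{th}}\}}\left(2^{I/(\tau B)}-2^{S/(\tau B)}\right)}{|h_t|^2},$$ where $\mathbb{I}_{\{L_t\le L_{\mathrm{th}}\}}=1$ if $L_t\le L_{\mathrm{th}}$ and $0$ otherwise.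
   Context: Data: an integer $T\ge1$; real constants $\tau,B,\sigma^2>0$; real constants $0<S<I$; nonzero complex numbers $h_1,\dots,h_T$; nonnegative reals $L_1,\dots,L_T$ (loss values); and a threshold $L_{\mathrm{th}}\ge0$. Problem $\mathsf{Q}_{\mathrm{GS}}$: minimize, over $\{p_t\}_{t=1}^T$ and $\{x_t\}_{t=1}^T$, the objective $\frac1T\sum_{t=1}^Tp_t$ subject to (a) $\frac1T\sum_{t=1}^TL_t(1-x_t)\le L_{\mathrm{th}}$; (b) $\tau B\log_2\left(1+\frac{|h_t|^2p_t}{\sigma^2}\right)\ge x_tI+(1-x_t)S$ for all $t$; (c) $x_t\in\{0,1\}$ and $p_t\ge0$ for all $t$. Problem $\mathsf{Q}_{\mathrm{GS}}'$: the same problem with the average constraint (a) replaced by the per-frame constraints $L_t(1-x_t)\le L_{\mathrm{th}}$ for all $t$. *)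

(* Defs.v *)
From HB Require Import structures.
From mathcomp Require Import all_boot all_order all_algebra.
From mathcomp Require Import complex.
From mathcomp Require Import all_classical all_reals all_analysis.

Set Implicit Arguments.
Unset Strict Implicit.
Unset Printing Implicit Defensive.

Import Order.TTheory GRing.Theory Num.Theory.
Local Open Scope ring_scope.

Definition log2 (R : realType) (y : R) : R := ln y / ln 2.

(* The modulus as an element of R: the generic norm `|z| of z : R[i] is
   itself R[i]-valued. *)
Definition cmodulus (R : realType) (z : R[i]) : R := ComplexField.Normc.normc z.

Definition minimizer (R : realType) (X : Type) (feasible : X -> Prop)
    (f : X -> R) (a : X) : Prop :=
  feasible a /\ forall b, feasible b -> f a <= f b.

(* A point (x, p) consists of the decisions x_t and the powers p_t; the frames
   t = 1, ..., T are indexed by 'I_T, i.e. shifted by one. *)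
Definition point (R : realType) (T : nat) : Type :=
  (('I_T -> R) * ('I_T -> R))%type.

Definition avg_power (R : realType) (T : nat) (z : point R T) : R :=
  T%:R^-1 * \sum_(t < T) z.2 t.

Definition avg_loss_constraint (R : realType) (T : nat)
    (L : 'I_T -> R) (Lth : R) (z : point R T) : Prop :=
  T%:R^-1 * \sum_(t < T) L t * (1 - z.1 t) <= Lth.

Definition frame_loss_constraint (R : realType) (T : nat)
    (L : 'I_T -> R) (Lth : R) (z : point R T) : Prop :=
  forall t, L t * (1 - z.1 t) <= Lth.

(* dI and dS stand for the constants I and S, whose names are those of
   constructors of True and nat. *)
Definition rate_constraint (R : realType) (T : nat)
    (tau B sigma2 dI dS : R) (h : 'I_T -> R[i]) (z : point R T) : Prop :=
  forall t, z.1 t * dI + (1 - z.1 t) * dS <=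
    tau * B * log2 (1 + cmodulus (h t) ^+ 2 * z.2 t / sigma2).

Definition domain_constraint (R : realType) (T : nat) (z : point R T) : Prop :=
  forall t, (z.1 t = 0 \/ z.1 t = 1) /\ 0 <= z.2 t.

Definition feasible_QGS (R : realType) (T : nat) (tau B sigma2 dI dS : R)
    (h : 'I_T -> R[i]) (L : 'I_T -> R) (Lth : R) (z : point R T) : Prop :=
  [/\ avg_loss_constraint L Lth z,
      rate_constraint tau B sigma2 dI dS h z
    & domain_constraint z].

Definition feasible_QGS' (R : realType) (T : nat) (tau B sigma2 dI dS : R)
    (h : 'I_T -> R[i]) (L : 'I_T -> R) (Lth : R) (z : point R T) : Prop :=
  [/\ frame_loss_constraint L Lth z,
      rate_constraint tau B sigma2 dI dS h z
    & domain_constraint z].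

Definition feasible_QGS_MR (R : realType) (T : nat) (tau B sigma2 dI dS : R)
    (h : 'I_T -> R[i]) (L : 'I_T -> R) (Lth : R) (z : point R T) : Prop :=
  feasible_QGS tau B sigma2 dI dS h L Lth z /\ forall t, z.1 t = 1.

(* Main.v *)
Require Import Defs.
From HB Require Import structures.
From mathcomp Require Import all_boot all_order all_algebra.
From mathcomp Require Import complex.
From mathcomp Require Import all_classical all_reals all_analysis.
From mathcomp Require Import ring.

Import Order.TTheory GRing.Theory Num.Theory.
Local Open Scope ring_scope.

(* Both objectives are separable in the frames once the decisions are fixed, and
   the rate constraint just says p_t >= minPower d_t with d_t = I or d_t = S.
   In QGS' the decision of a frame is free exactly when L_t <= Lth, in which
   case x_t = 0 is strictly cheaper; an optimal power allocation therefore
   attains the pointwise lower bound in every frame. *)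

Definition minPower {R : realType} (tau B sigma2 d : R) (z : R[i]) : R :=
  sigma2 * (2 `^ (d / (tau * B)) - 1) / cmodulus z ^+ 2.

Lemma cmodulus_sqr_gt0 {R : realType} {z : R[i]} :
  z <> 0 -> 0 < cmodulus z ^+ 2.
Proof.
move=> z0; rewrite exprn_even_gt0 //=; apply/eqP => /ComplexField.Normc.eq0_normc.
exact: z0.
Qed.

Lemma le_log2 (R : realType) (y a : R) :
  0 < y -> (a <= log2 y) = (2 `^ a <= y).
Proof.
move=> y0; have ln2_gt0 : 0 < ln (2 : R) by rewrite ln_gt0 // ltr1n.
by rewrite /log2 ler_pdivlMr // -ln_powR ler_ln // posrE ?powR_gt0.
Qed.

(** Dividing by [tau * B] and exponentiating in base 2 leaves an inequality linear in [p]; [0 <= p]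
    keeps the argument of [log2] positive, so each step is an equivalence. *)
Lemma rate_minPower (R : realType) (tau B sigma2 d p : R) (z : R[i]) :
  0 < tau -> 0 < B -> 0 < sigma2 -> z <> 0 -> 0 <= p ->
  (d <= tau * B * log2 (1 + cmodulus z ^+ 2 * p / sigma2)) =
  (minPower tau B sigma2 d z <= p).
Proof.
move=> tau0 B0 s0 /cmodulus_sqr_gt0 c0 p0.
rewrite -ler_pdivrMl ?mulr_gt0 // [_^-1 * d]mulrC le_log2; last first.
  apply: ltr_wpDr => //; apply: divr_ge0; last exact: ltW.
  by rewrite mulr_ge0 ?sqr_ge0.
rewrite /minPower ler_pdivrMr // -ler_pdivlMl // lerBlDl.
by congr (_ <= 1 + _); ring.
Qed.

Lemma minPower_ge0 (R : realType) (tau B sigma2 d : R) (z : R[i]) :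
  0 < tau -> 0 < B -> 0 < sigma2 -> 0 <= d ->
  0 <= minPower tau B sigma2 d z.
Proof.
move=> tau0 B0 s0 d0; rewrite /minPower divr_ge0 ?sqr_ge0 //.
(* Reading 1 as the zeroth power of 2 reduces the claim to a comparison of exponents. *)
rewrite pmulr_rge0 // subr_ge0 -[leLHS](powRr0 2) ler_powR ?ler1n //.
by rewrite divr_ge0 ?mulr_ge0 // ltW.
Qed.

Lemma minPower_le (R : realType) (tau B sigma2 d e : R) (z : R[i]) :
  0 < tau -> 0 < B -> 0 < sigma2 -> d <= e ->
  minPower tau B sigma2 d z <= minPower tau B sigma2 e z.
Proof.
move=> tau0 B0 s0 de; rewrite ler_wpM2r ?invr_ge0 ?sqr_ge0 //.
rewrite ler_pM2l // lerD2r ler_powR ?ler1n //.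
by rewrite ler_pM2r // invr_gt0 mulr_gt0.
Qed.

(** Optimality bounds the sum of [p] by that of [q], so the nonnegative differences [p t - q t] sum
    to zero and each vanishes. The decisions [x] and [y] may differ. *)
Lemma minimizer_eq_lower_bound {R : realType} {T : nat}
    {feasible : Defs.point R T -> Prop} {x p y q : 'I_T -> R} :
  minimizer feasible (@avg_power R T) (x, p) ->
  feasible (y, q) -> (forall t, q t <= p t) -> p =1 q.
Proof.
(* Without frames the claim is vacuous; otherwise the factor [T%:R^-1] is positive and cancels. *)
case: T feasible x p y q => [|T] feasible x p y q; first by move=> _ _ _ [].
move=> [_ /(_ (y, q)) min_p] /min_p {min_p}.
rewrite /avg_power /= ler_pM2l ?invr_gt0 ?ltr0Sn // => le_sum le_qp t.
apply/eqP; rewrite -subr_eq0; apply/eqP.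
apply: (@psumr_eq0P _ _ predT (fun t => p t - q t)) => // [i _|].
  by rewrite subr_ge0.
apply/le_anti; rewrite sumrB subr_le0 le_sum /= subr_ge0.
exact: ler_sum.
Qed.

Theorem mainTheorem4 (R : realType) (T : nat) (tau B sigma2 dS dI Lth : R)
    (h : 'I_T -> R[i]) (L : 'I_T -> R)
    (hT : (1 <= T)%N) (htau : 0 < tau) (hB : 0 < B) (hsigma2 : 0 < sigma2)
    (hS : 0 < dS) (hSI : dS < dI) (hh : forall t, h t <> 0)
    (hL : forall t, 0 <= L t) (hLth : 0 <= Lth)
    (xstar pstar xMR pMR : 'I_T -> R)
    (hstar : minimizer (feasible_QGS' tau B sigma2 dI dS h L Lth)
               (@avg_power R T) (xstar, pstar))
    (hMR : minimizer (feasible_QGS_MR tau B sigma2 dI dS h L Lth)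
             (@avg_power R T) (xMR, pMR)) :
  (forall t, pMR t =
     sigma2 * (2 `^ (dI / (tau * B)) - 1) / cmodulus (h t) ^+ 2) /\
  \sum_(t < T) pMR t - \sum_(t < T) pstar t =
    \sum_(t < T) sigma2 * (L t <= Lth)%R%:R *
      (2 `^ (dI / (tau * B)) - 2 `^ (dS / (tau * B))) / cmodulus (h t) ^+ 2.
Proof.
pose P d t := minPower tau B sigma2 d (h t).
have hI : 0 < dI by exact: lt_trans hSI.
have rateP d t p : 0 <= p ->
    (d <= tau * B * log2 (1 + cmodulus (h t) ^+ 2 * p / sigma2)) = (P d t <= p).
  by move=> p0; apply: rate_minPower.
have P_ge0 d t : 0 < d -> 0 <= P d t by move=> d0; apply: minPower_ge0 => //; exact: ltW.
have MR_eq : pMR =1 P dI.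
  have [[[_ rate dom] /= x1] _] := hMR.
  apply: (minimizer_eq_lower_bound (y := fun=> 1) hMR) => [|t].
    split=> //; split=> [|t|t] /=.
    (* With every decision equal to 1 the average loss is 0, which is at most [Lth]. *)
    - by rewrite /avg_loss_constraint /= big1 ?mulr0 // => t _; rewrite subrr mulr0.
    - by rewrite subrr mul0r addr0 mul1r rateP ?P_ge0.
    - by split; [right | exact: P_ge0].
  have [_ /= p0] := dom t.
  by rewrite -rateP //; have := rate t; rewrite /= x1 subrr mul0r addr0 mul1r.
have star_eq : pstar =1 fun t => if L t <= Lth then P dS t else P dI t.
  have [[loss rate dom] _] := hstar.
  (* The competitor chooses 0 in every frame whose loss permits it. *)
  apply: (minimizer_eq_lower_bound
            (y := fun t => if L t <= Lth then 0 else 1) hstar) => [|t].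
    split=> t /=; case: ifP => Lt.
    - by rewrite subr0 mulr1.
    - by rewrite subrr mulr0.
    - by rewrite mul0r add0r subr0 mul1r rateP ?P_ge0.
    - by rewrite subrr mul0r addr0 mul1r rateP ?P_ge0.
    - by split; [left | exact: P_ge0].
    - by split; [right | exact: P_ge0].
  have [/= xt p0] := dom t; have /= := loss t; have /= := rate t.
  case: xt => ->.
    (* For decision 0 the loss constraint reads [L t <= Lth], which selects the branch [P dS t]. *)
    by rewrite mul0r add0r subr0 mul1r mulr1 rateP // => ? ->.
  rewrite subrr mul0r addr0 mul1r rateP // => le_p _.
  (* For decision 1 the power is at least [P dI t], which also dominates [P dS t]. *)
  case: ifP => // _; apply: le_trans le_p.
  by apply: minPower_le => //; exact: ltW.
split=> [//|]; rewrite -sumrB; apply: eq_bigr => t _.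
(* Only frames with [L t <= Lth] save power; in the others both allocations equal [P dI t]. *)
rewrite MR_eq star_eq /P /minPower; case: ifP => _ /=; ring.
Qed.
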